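(* Let $\mathcal{A}$ be a unital $C^*$-algebra with unit $e$ and let $\alpha>0$. If $x$ and $y$ are linearly independent elements in a pre-Hilbert $\mathcal{A}$-module such that $|y|^2=\alpha e$, then the following conditions are equivalent: (i) $x$ and $y$ are orthogonal in the Pythagoras sense, i.e. $\|x+\lambda y\|^2=\|x\|^2+|\lambda|^2\|y\|^2$ for every $\lambda\in\mathbb{C}$. (ii) $x$ and $y$ satisfy the parallelogram law, i.e. $\|x+\lambda y\|^2+\|x-\lambda y\|^2=2(\|x\|^2+|\lambda|^2\|y\|^2)$ for every $\lambda\in\mathbb{C}$, and are Birkhoff--James orthogonal, i.e. $\|x+\lambda y\|\ge\|x\|$ for every $\lambda\in\mathbb{C}$.
   Context: A (right) pre-Hilbert $\mathcal{A}$-module $\mathscr{E}$ is a complex linear space that is a right $\mathcal{A}$-module with compatible scalar multiplication, equipped with an $\mathcal{A}$-valued inner product $\langle\cdot,\cdot\rangle$ (conjugate-linear in the first and linear in the second variable) such that $\langle x,x\rangle\ge 0$ with equality iff $x=0$, $\langle x,y\rangle^*=\langle y,x\rangle$, and $\langle x,ya\rangle=\langle x,y\rangle a$. Completeness is not assumed. For $x\in\mathscr{E}$, $|x|:=\langle x,x\rangle^{1/2}\in\mathcal{A}$ and $\|x\|:=\||x|\|_{\mathcal{A}}$. *)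

(* Defs.v *)
From HB Require Import structures.
From mathcomp Require Import all_boot all_order all_algebra.
From mathcomp Require Import complex.
From mathcomp Require Import boolp classical_sets reals.

Set Implicit Arguments.
Unset Strict Implicit.
Unset Printing Implicit Defensive.

Import Order.TTheory GRing.Theory Num.Theory.
Import ComplexField.Normc.

Local Open Scope classical_set_scope.
Local Open Scope ring_scope.
Local Open Scope complex_scope.

(* algType excludes the zero algebra; in a pre-Hilbert module over the zero
   algebra every vector is zero.
   The norm is a field of the mixin: Hierarchy Builder does not accept a join
   of NormedModule with a noncommutative ring structure, since NumDomain is
   already the join of the two hierarchies. *)
HB.mixin Record isCStarAlgebra (R : realType) A of GRing.Algebra R[i] A := {
  cnorm : A -> R;
  cnorm_eq0 : forall a : A, cnorm a = 0 -> a = 0;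
  cnormD : forall a b : A, cnorm (a + b) <= cnorm a + cnorm b;
  cnormZ : forall (c : R[i]) (a : A), cnorm (c *: a) = normc c * cnorm a;
  cnormM : forall a b : A, cnorm (a * b) <= cnorm a * cnorm b;
  cnorm_complete : forall u : nat -> A,
    (forall e : R, 0 < e -> exists N : nat, forall m n : nat,
       (N <= m)%N -> (N <= n)%N -> cnorm (u m - u n) < e) ->
    exists a : A, forall e : R, 0 < e -> exists N : nat, forall n : nat,
      (N <= n)%N -> cnorm (u n - a) < e;
  star : A -> A;
  starK : forall a : A, star (star a) = a;
  starD : forall a b : A, star (a + b) = star a + star b;
  starZ : forall (c : R[i]) (a : A), star (c *: a) = c^* *: star a;
  starM : forall a b : A, star (a * b) = star b * star a;
  cnorm_starM : forall a : A, cnorm (star a * a) = cnorm a ^+ 2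
}.

#[short(type="cstarAlgType")]
HB.structure Definition CStarAlgebra (R : realType) :=
  {A of isCStarAlgebra R A & GRing.Algebra R[i] A}.

Definition spectrum (R : realType) (A : cstarAlgType R) (a : A) : set R[i] :=
  [set l | ~ exists b : A, (a - l%:A) * b = 1 /\ b * (a - l%:A) = 1].

(* The condition 0 <= l in R[i] includes that l is real. *)
Definition cstar_pos (R : realType) (A : cstarAlgType R) (a : A) : Prop :=
  star a = a /\ forall l : R[i], spectrum a l -> 0 <= l.

(* A positive element has exactly one positive square root, so the default
   value 0 is only taken at non-positive elements. *)
Definition cstar_sqrt (R : realType) (A : cstarAlgType R) (a : A) : A :=
  xget 0 [set b : A | cstar_pos b /\ b ^+ 2 = a].

(* MathComp has no right modules, and the carrier already bears the scalar
   action of R[i]; hence the explicit right action ract. *)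
HB.mixin Record isPreHilbertModule (R : realType) (A : cstarAlgType R) E
    of GRing.Lmodule R[i] E := {
  ract : E -> A -> E;
  ractDl : forall (x y : E) (a : A), ract (x + y) a = ract x a + ract y a;
  ractDr : forall (x : E) (a b : A), ract x (a + b) = ract x a + ract x b;
  ractM : forall (x : E) (a b : A), ract x (a * b) = ract (ract x a) b;
  ract1 : forall x : E, ract x 1 = x;
  ractZl : forall (c : R[i]) (x : E) (a : A), ract (c *: x) a = c *: ract x a;
  ractZr : forall (c : R[i]) (x : E) (a : A), ract x (c *: a) = c *: ract x a;
  inner : E -> E -> A;
  innerDl : forall x y z : E, inner (x + y) z = inner x z + inner y z;
  innerZl : forall (c : R[i]) (x y : E),
    inner (c *: x) y = c^* *: inner x y;
  innerDr : forall x y z : E, inner x (y + z) = inner x y + inner x z;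
  innerZr : forall (c : R[i]) (x y : E), inner x (c *: y) = c *: inner x y;
  inner_pos : forall x : E, cstar_pos (inner x x);
  inner_eq0 : forall x : E, inner x x = 0 <-> x = 0;
  inner_star : forall x y : E, star (inner x y) = inner y x;
  inner_ract : forall (x y : E) (a : A), inner x (ract y a) = inner x y * a
}.

#[short(type="preHilbertModType")]
HB.structure Definition PreHilbertModule (R : realType) (A : cstarAlgType R) :=
  {E of isPreHilbertModule R A E & GRing.Lmodule R[i] E}.

Section ModuleNotions.
Context (R : realType) (A : cstarAlgType R) (E : preHilbertModType A).

Definition mod_abs (x : E) : A := cstar_sqrt (inner x x).

Definition mod_norm (x : E) : R := cnorm (mod_abs x).

Definition lin_indep2 (x y : E) : Prop :=
  forall a b : R[i], a *: x + b *: y = 0 -> a = 0 /\ b = 0.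

Definition pythagoras_orthogonal (x y : E) : Prop :=
  forall l : R[i],
    mod_norm (x + l *: y) ^+ 2 = mod_norm x ^+ 2 + normc l ^+ 2 * mod_norm y ^+ 2.

Definition parallelogram_law (x y : E) : Prop :=
  forall l : R[i],
    mod_norm (x + l *: y) ^+ 2 + mod_norm (x - l *: y) ^+ 2
    = 2 * (mod_norm x ^+ 2 + normc l ^+ 2 * mod_norm y ^+ 2).

Definition birkhoff_james_orthogonal (x y : E) : Prop :=
  forall l : R[i], mod_norm x <= mod_norm (x + l *: y).

End ModuleNotions.

(* Main.v *)
Require Import Defs.
From mathcomp Require Import all_boot all_order all_algebra.
From mathcomp Require Import complex.
From mathcomp Require Import boolp classical_sets reals.
From mathcomp Require Import ring lra.

(* Positivity is spectral, but all the estimates use the norm cone of the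
   self-adjoint [a] with [‖r - a‖ <= r] for some real [r].  A square root of an
   element of the cone comes from a monotone iteration, and for commuting
   self-adjoint [s], [t] with [s^2 + t^2 = k], the C*-identity for [s + i t]
   gives [‖s‖^2 <= k]; hence squares are in the cone and [‖z‖ <= k] for [z] in
   the cone if and only if [k - z] is in it.  A positive element is in the cone
   by a continuation argument on [a + t], so that square roots exist and
   [‖x‖^2 = ‖<x, x>‖].

   As [|y|^2 = alpha e], the function [‖x + t l y‖^2 - t^2 |l|^2 alpha] of a real
   [t] is convex.  Birkhoff-James orthogonality then gives
   [‖x + l y‖^2 >= ‖x‖^2 + |l|^2 alpha] for every [l], and the parallelogram law
   turns the inequalities at [l] and [- l] into equalities. *)

Import Order.TTheory GRing.Theory Num.Theory.
Import ComplexField.Normc.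

Local Open Scope ring_scope.
Local Open Scope complex_scope.

(** * Norm, involution and limits of sequences *)

Section Norm.
Context {R : realType} {A : cstarAlgType R}.
Implicit Types (a b : A) (r : R) (u v : nat -> A).

Lemma normc_real r : normc r%:C = `|r|.
Proof. by rewrite /= expr0n addr0 sqrtr_sqr. Qed.

Lemma conj_real r : (r%:C)^*%R = r%:C :> R[i].
Proof. exact: conjc_real. Qed.

Lemma cnorm0 : cnorm (0 : A) = 0.
Proof. by rewrite -(scale0r (0 : A)) cnormZ normc0 mul0r. Qed.

Lemma cnormN a : cnorm (- a) = cnorm a.
Proof. by rewrite -scaleN1r cnormZ normcN normc1 mul1r. Qed.

Lemma cnorm_ge0 a : 0 <= cnorm a.
Proof. by have := cnormD a (- a); rewrite subrr cnorm0 cnormN; lra. Qed.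

Lemma cnorm_distC a b : cnorm (a - b) = cnorm (b - a).
Proof. by rewrite -cnormN opprB. Qed.

Lemma cnorm_triangle c a b : cnorm (a - b) <= cnorm (a - c) + cnorm (c - b).
Proof. by rewrite -{1}(subrK c a) -(addrA (a - c)) cnormD. Qed.

Lemma star0 : star (0 : A) = 0.
Proof. by rewrite -(scale0r (0 : A)) starZ rmorph0 !scale0r. Qed.

Lemma starN a : star (- a) = - star a.
Proof. by apply/eqP; rewrite -subr_eq0 opprK -starD addNr star0. Qed.

Lemma starB a b : star (a - b) = star a - star b.
Proof. by rewrite starD starN. Qed.

Lemma star1 : star (1 : A) = 1.
Proof. by rewrite -[star 1]mulr1 -[X in _ * X](starK 1) -starM mulr1 starK. Qed.

Lemma cnorm1 : cnorm (1 : A) = 1.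
Proof.
have n0 : cnorm (1 : A) != 0.
  by apply/eqP => /cnorm_eq0/eqP; rewrite oner_eq0.
by apply: (mulfI n0); rewrite mulr1 -expr2 -cnorm_starM star1 mulr1.
Qed.

Lemma cnorm_star a : cnorm (star a) = cnorm a.
Proof.
have le_star b : cnorm b <= cnorm (star b).
  have := cnormM (star b) b; rewrite cnorm_starM expr2.
  have [->|b0] := eqVneq (cnorm b) 0; first by rewrite cnorm_ge0.
  by rewrite ler_pM2r // lt_def b0 cnorm_ge0.
by apply/eqP; rewrite eq_le le_star -{2}(starK a) le_star.
Qed.

Lemma cnorm_sqr a : star a = a -> cnorm (a * a) = cnorm a ^+ 2.
Proof. by move=> sa; rewrite -{1}sa cnorm_starM. Qed.

Lemma cnormZr r a : cnorm (r%:C *: a) = `|r| * cnorm a.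
Proof. by rewrite cnormZ normc_real. Qed.

Lemma starZr r a : star (r%:C *: a) = r%:C *: star a.
Proof. by rewrite starZ conj_real. Qed.

Lemma cnorm_real r : cnorm (r%:C%:A : A) = `|r|.
Proof. by rewrite cnormZr cnorm1 mulr1. Qed.

Lemma star_real r : star (r%:C%:A : A) = r%:C%:A.
Proof. by rewrite starZr star1. Qed.

Definition clim u a := forall e : R, 0 < e -> exists N : nat, forall n : nat,
  (N <= n)%N -> cnorm (u n - a) < e.

Lemma clim_cst a : clim (fun=> a) a.
Proof. by move=> e e0; exists 0%N => n _; rewrite subrr cnorm0. Qed.

Lemma clim_shift u a : clim u a -> clim (fun n => u n.+1) a.
Proof.
by move=> ua e /ua[N uN]; exists N => n Nn; apply: uN; apply: leqW.
Qed.

Lemma climD u v a b : clim u a -> clim v b -> clim (fun n => u n + v n) (a + b).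
Proof.
move=> ua vb e e0; have e2 : 0 < e / 2 by lra.
have [N uN] := ua _ e2; have [M vM] := vb _ e2.
exists (maxn N M) => n; rewrite geq_max => /andP[/uN un /vM vn].
rewrite opprD addrACA; apply: le_lt_trans (cnormD _ _) _; lra.
Qed.

Lemma climM u v a b : clim u a -> clim v b -> clim (fun n => u n * v n) (a * b).
Proof.
move=> ua vb e e0; set k := cnorm a + cnorm b + 1.
have a0 := cnorm_ge0 a; have b0 := cnorm_ge0 b.
have k1 : 1 <= k by rewrite /k; lra.
(* The bound 1 linearises the product of the two errors, so the total error is at most
   [d * (1 + ‖a‖ + ‖b‖) = d * k = e / 2]. *)
have d0 : 0 < Num.min 1 (e / (2 * k)).
  by rewrite lt_min ltr01 divr_gt0 //; lra.
have [N uN] := ua _ d0; have [M vM] := vb _ d0.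
exists (maxn N M) => n; rewrite geq_max => /andP[/uN un /vM vn].
have -> : u n * v n - a * b = (u n - a) * (v n - b) + (u n - a) * b + a * (v n - b).
  by rewrite -mulrDr subrK mulrBl mulrBr addrA subrK.
move: un vn; rewrite !lt_min => /andP[_ un] /andP[v1 vn].
apply: le_lt_trans (cnormD _ _) _.
apply: le_lt_trans (lerD (cnormD _ _) (lexx _)) _.
apply: le_lt_trans (lerD (lerD (cnormM _ _) (cnormM _ _)) (cnormM _ _)) _.
set d := e / (2 * k) in un vn.
have de : d * k = e / 2 by rewrite /d; field; lra.
move: (cnorm_ge0 (u n - a)) (cnorm_ge0 (v n - b)) un vn v1.
move: (cnorm (u n - a)) (cnorm (v n - b)) => p q p0 q0 pd qd q1.
have : p * q + p * cnorm b <= d * (1 + cnorm b).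
  by rewrite -mulrDr ler_pM //; lra.
have : cnorm a * q <= d * cnorm a by rewrite mulrC ler_wpM2r //; lra.
by rewrite /k in de; nra.
Qed.

Lemma clim_star u a : clim u a -> clim (fun n => star (u n)) (star a).
Proof.
by move=> ua e /ua[N uN]; exists N => n /uN; rewrite -starB cnorm_star.
Qed.

Lemma clim_norm_le u a r : (forall n, cnorm (u n) <= r) -> clim u a -> cnorm a <= r.
Proof.
move=> ur ua; apply/ler_addgt0Pr => e /ua[N /(_ N (leqnn N)) uN].
have := cnorm_triangle (u N) a 0; rewrite !subr0 cnorm_distC.
have := ur N; lra.
Qed.

Lemma clim_unique u a b : clim u a -> clim u b -> a = b.
Proof.
move=> ua ub; apply/eqP; rewrite -subr_eq0; apply/eqP/cnorm_eq0/eqP.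
rewrite eq_le cnorm_ge0 andbT; apply/ler_addgt0Pr => e e0; rewrite add0r.
have e2 : 0 < e / 2 by lra.
have [N uN] := ua _ e2; have [M uM] := ub _ e2.
have := uN _ (leq_maxl N M); have := uM _ (leq_maxr N M).
have := cnorm_triangle (u (maxn N M)) a b; rewrite (cnorm_distC a (u _)); lra.
Qed.

(** The increments of [v] bound norms, so [v] is nondecreasing and bounded, hence Cauchy;
    telescoping carries this over to [u]. *)
Lemma clim_dominated u (v : nat -> R) r :
  (forall n, cnorm (u n.+1 - u n) <= v n.+1 - v n) -> (forall n, v n <= r) ->
  exists a, clim u a.
Proof.
move=> uv vr.
have dist n k : cnorm (u (n + k)%N - u n) <= v (n + k)%N - v n.
  elim: k => [|k IHk]; first by rewrite addn0 !subrr cnorm0.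
  rewrite addnS; have := cnorm_triangle (u (n + k)%N) (u (n + k).+1) (u n).
  by have := uv (n + k)%N; lra.
have supv : has_sup (range v).
  by split; [exists (v 0%N), 0%N | exists r => _ [n _ <-]; apply: vr].
have vsup n : v n <= sup (range v) by apply: ub_le_sup; [case: supv | exists n].
apply: cnorm_complete => e e0; have e2 : 0 < e / 2 by lra.
have [_ [N _ <-] vN] := sup_adherent e2 supv.
have close n : (N <= n)%N -> cnorm (u n - u N) < e / 2.
  by move=> Nn; have := dist N (n - N)%N; rewrite subnKC // => ?; have := vsup n; lra.
exists N => m n /close um /close un.
by have := cnorm_triangle (u N) (u m) (u n); rewrite (cnorm_distC (u N)); lra.
Qed.

(** * Neumann series and square roots by iteration *)

Lemma neumann a : cnorm a < 1 -> exists b, (1 - a) * b = 1 /\ b * (1 - a) = 1.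
Proof.
move=> a1; have a0 := cnorm_ge0 a.
(* Partial sums of the geometric series in Horner form; [v] is the series of [‖a‖], bounded by its
   sum. *)
pose u := fix u n : A := if n is m.+1 then 1 + a * u m else 1.
pose v := fix v n : R := if n is m.+1 then 1 + cnorm a * v m else 1.
have comm n : a * u n = u n * a.
  elim: n => [|n IHn] /=; rewrite ?mulr1 ?mul1r //.
  by rewrite mulrDl mulrDr mulr1 mul1r {1}IHn mulrA.
have [b ub] : exists b, clim u b.
  apply: (clim_dominated u v (1 - cnorm a)^-1) => n.
    elim: n => [|n IHn].
      by rewrite /= addrAC subrr add0r mulr1 addrAC subrr add0r mulr1.
    have -> : u n.+2 - u n.+1 = a * (u n.+1 - u n).
      rewrite mulrBr -[u n.+2]/(1 + a * u n.+1).
      by rewrite -[X in _ - X = _]/(1 + a * u n) opprD addrACA subrr add0r.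
    have -> : v n.+2 - v n.+1 = cnorm a * (v n.+1 - v n) by rewrite /=; ring.
    by apply: le_trans (cnormM _ _) _; apply: ler_wpM2l.
  elim: n => [|n IHn].
    by rewrite /= -(ler_pM2r (x := 1 - cnorm a)) ?mulVf; lra.
  have e : 1 + cnorm a * (1 - cnorm a)^-1 = (1 - cnorm a)^-1 by field; lra.
  by rewrite -e /= lerD2l ler_wpM2l.
have bE : b = 1 + a * b.
  apply: clim_unique (clim_shift _ _ ub) _.
  by apply: climD; [exact: clim_cst | apply: climM ub; exact: clim_cst].
have abC : a * b = b * a.
  apply: (clim_unique (fun n => a * u n)).
    by apply: climM ub; exact: clim_cst.
  under eq_fun do rewrite comm.
  by apply: climM ub _; exact: clim_cst.
exists b; rewrite mulrBl mulrBr -abC mulr1 mul1r.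
by split; rewrite {1}bE addrK.
Qed.

(* The monotone iteration [x := (c + x^2) / 2] is dominated in norm by the
   same iteration on the real numbers with [c = 1]. *)
Lemma sqrt_one_minus c : star c = c -> cnorm c <= 1 -> exists x : A,
  [/\ star x = x, cnorm x <= 1, (1 - x) * (1 - x) = 1 - c &
      forall w, w * c = c * w -> w * x = x * w].
Proof.
move=> sc c1; pose h : A := (2^-1)%:C%:A.
have hC w : w * h = h * w by rewrite mulr_algr mulr_algl.
pose u := fix u n : A := if n is m.+1 then h * (c + u m * u m) else 0.
pose v := fix v n : R := if n is m.+1 then 2^-1 * (1 + v m * v m) else 0.
have su n : star (u n) = u n.
  elim: n => [|n IHn] /=; first exact: star0.
  by rewrite starM starD starM sc IHn star_real hC.
have comm w : w * c = c * w -> forall n, w * u n = u n * w.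
  move=> wc; elim=> [|n IHn] /=; first by rewrite mulr0 mul0r.
  by rewrite mulrA hC -!mulrA mulrDr mulrDl wc mulrA IHn -!mulrA IHn.
(* Every iterate commutes with [c], hence with every other iterate; this lets a difference of
   squares factor below. *)
have uC m n : u m * u n = u n * u m by apply/comm/esym/comm.
have v01 n : 0 <= v n <= 1.
  by elim: n => [|n /andP[v0 v1]] /=; [lra | apply/andP; split; nra].
have uv n : cnorm (u n) <= v n.
  elim: n => [|n IHn] /=; first by rewrite cnorm0.
  apply: le_trans (cnormM _ _) _; rewrite cnorm_real ger0_norm; last lra.
  apply: ler_wpM2l; first lra.
  apply: le_trans (cnormD _ _) _; apply: lerD => //.
  apply: le_trans (cnormM _ _) _; apply: ler_pM => //; exact: cnorm_ge0.
have [x ux] : exists x, clim u x.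
  apply: (clim_dominated u v 1) => n; last by case/andP: (v01 n).
  elim: n => [|n IHn].
    by have := uv 1%N; rewrite /= !subr0.
  have -> : u n.+2 - u n.+1 = h * ((u n.+1 + u n) * (u n.+1 - u n)).
    have -> : (u n.+1 + u n) * (u n.+1 - u n) = u n.+1 * u n.+1 - u n * u n.
      by rewrite mulrDl !mulrBr (uC n) addrA subrK.
    rewrite -[u n.+2]/(h * (c + u n.+1 * u n.+1)) -[X in _ - X = _]/(h * (c + u n * u n)).
    by rewrite -mulrBr opprD addrACA subrr add0r.
  have -> : v n.+2 - v n.+1 = 2^-1 * ((v n.+1 + v n) * (v n.+1 - v n)).
    by rewrite /=; ring.
  apply: le_trans (cnormM _ _) _; rewrite cnorm_real ger0_norm; last lra.
  apply: ler_wpM2l; first lra.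
  apply: le_trans (cnormM _ _) _; apply: ler_pM => //; try exact: cnorm_ge0.
  by apply: le_trans (cnormD _ _) _; apply: lerD.
have xE : x = h * (c + x * x).
  apply: clim_unique (clim_shift _ _ ux) _.
  apply: climM; first exact: clim_cst.
  by apply: climD; [exact: clim_cst | exact: climM].
(* The fixed-point equation, which is [(1 - x)^2 = 1 - c] expanded. *)
have x2E : x + x = c + x * x.
  by rewrite {1 2}xE -mulrDl -scalerDl -rmorphD -div1r -splitr scale1r mul1r.
exists x; split.
- have := clim_star _ _ ux; under eq_fun do rewrite su.
  by move=> uxs; exact: clim_unique uxs ux.
- by apply: clim_norm_le ux => n; apply: le_trans (uv n) _; case/andP: (v01 n).
- have -> : c = x + x - x * x by rewrite x2E addrK.
  rewrite mulrBl mul1r mulrBr mulr1 -addrA; congr (1 + _).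
  by rewrite !opprB opprD addrCA.
- move=> w wc; apply: (clim_unique (fun n => w * u n)).
    by apply: climM ux; exact: clim_cst.
  under eq_fun do rewrite (comm w wc).
  by apply: climM ux _; exact: clim_cst.
Qed.

End Norm.

(** * The norm cone: square roots and norm bounds *)

Section NormCone.
Context {R : realType} {A : cstarAlgType R}.
Implicit Types (a b s z : A) (r k : R).

Definition norm_cone a := star a = a /\ exists r : R, cnorm (r%:C%:A - a) <= r.

Lemma norm_coneD a b : norm_cone a -> norm_cone b -> norm_cone (a + b).
Proof.
move=> [sa [r ra]] [sb [t tb]]; split; first by rewrite starD sa sb.
exists (r + t); rewrite rmorphD scalerDl opprD addrACA.
by apply: le_trans (cnormD _ _) _; apply: lerD.
Qed.

Lemma norm_coneZ k a : 0 <= k -> norm_cone a -> norm_cone (k%:C *: a).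
Proof.
move=> k0 [sa [r ra]]; split; first by rewrite starZr sa.
exists (k * r); rewrite rmorphM -scalerA -scalerBr cnormZr ger0_norm //.
exact: ler_wpM2l.
Qed.

Lemma norm_cone_sub k a : star a = a -> cnorm a <= k -> norm_cone (k%:C%:A - a).
Proof.
move=> sa ak; split; first by rewrite starB star_real sa.
by exists k; rewrite subKr.
Qed.

(** Dividing by the radius puts [a / r] within distance 1 of the unit, so [sqrt_one_minus] applies.
    The commutation clause makes the roots of commuting elements commute. *)
Lemma norm_cone_sqrt a : norm_cone a -> exists s, exists r : R,
  [/\ star s = s, s * s = a, cnorm (r%:C%:A - s) <= r &
      forall w, w * a = a * w -> w * s = s * w].
Proof.
move=> [sa [r0 ra0]].
(* [r0] may be 0; enlarging the radius keeps the disc bound and allows division. *)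
pose r := r0 + 1.
have r_gt0 : 0 < r by have := cnorm_ge0 (r0%:C%:A - a); rewrite /r; lra.
have ra : cnorm (r%:C%:A - a) <= r.
  rewrite rmorphD scalerDl addrAC scale1r.
  by apply: le_trans (cnormD _ _) _; rewrite cnorm1 lerD2r.
have rC : r%:C != 0 :> R[i] by rewrite fmorph_eq0 gt_eqF.
pose c := 1 - (r^-1)%:C *: a.
have cE : c = (r^-1)%:C *: (r%:C%:A - a).
  by rewrite scalerBr scalerA -rmorphM mulVf ?gt_eqF // scale1r.
have sc : star c = c by rewrite starB star1 starZr sa.
have c1 : cnorm c <= 1.
  rewrite cE cnormZr ger0_norm; last by rewrite invr_ge0 ltW.
  by rewrite ler_pdivrMl // mulr1.
have [x [sx x1 x2 xcomm]] := sqrt_one_minus _ sc c1.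
exists ((Num.sqrt r)%:C *: (1 - x)), (Num.sqrt r); split.
- by rewrite starZr starB star1 sx.
- rewrite -scalerAl -scalerAr scalerA x2 -rmorphM -expr2 sqr_sqrtr ?ltW //.
  by rewrite /c subKr scalerA -rmorphM mulfV ?gt_eqF // scale1r.
- rewrite -scalerBr subKr cnormZr ger0_norm ?sqrtr_ge0 //.
  by rewrite -[leRHS]mulr1 ler_wpM2l ?sqrtr_ge0.
- move=> w wa; rewrite -scalerAl -scalerAr mulrBr mulrBl mulr1 mul1r xcomm //.
  by rewrite mulrBr mulrBl mulr1 mul1r -scalerAl -scalerAr wa.
Qed.

(* [u := s + i t] satisfies [star u * u = k], and [s] is its real part. *)
Lemma cnorm_le_of_sum_sqr s t k : star s = s -> star t = t -> s * t = t * s ->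
  s * s + t * t = k%:C%:A -> cnorm s ^+ 2 <= `|k|.
Proof.
move=> ss st stC sum; pose u := s + 'i%C *: t.
have su : star u = s - 'i%C *: t.
  rewrite starD starZ ss st; congr (_ + _); rewrite -scaleNr; congr (_ *: _).
  by apply/eqP; rewrite eq_complex /= oppr0 !eqxx.
have uu : star u * u = k%:C%:A.
  rewrite su mulrBl !mulrDr -!scalerAl -!scalerAr scalerA stC opprD.
  rewrite addrA addrK -sum; congr (_ + _).
  rewrite -scaleNr -[RHS]scale1r; congr (_ *: _).
  by apply/eqP; rewrite eq_complex /=; apply/andP; split; apply/eqP; ring.
have un : cnorm u ^+ 2 = `|k| by rewrite -cnorm_starM uu cnorm_real.
have sE : 2%:C *: s = u + star u.
  by rewrite su addrACA subrr addr0 -mulr2n -scaler_nat rmorph_nat.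
have : 2 * cnorm s <= cnorm u + cnorm u.
  rewrite -{2}(cnorm_star u) -[2 in leLHS]ger0_norm // -cnormZr sE; exact: cnormD.
by rewrite -un => ?; apply: lerXn2r; rewrite ?nnegrE ?cnorm_ge0 //; lra.
Qed.

(** The roots [s] of [z] and [t] of [k - z] commute and satisfy [s^2 + t^2 = k]. *)
Lemma cnorm_le_of_cone k z : norm_cone z -> norm_cone (k%:C%:A - z) -> cnorm z <= k.
Proof.
move=> zP kP; have k0 : 0 <= k.
  have [_ [r]] := norm_coneD _ _ zP kP.
  rewrite (addrC z) subrK -scalerBl -rmorphB cnorm_real.
  by have := ler_norm (r - k); lra.
have [s [_ [ss sz _ sC]]] := norm_cone_sqrt _ zP.
have [t [_ [st tz _ tC]]] := norm_cone_sqrt _ kP.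
have stC : s * t = t * s.
  apply: tC; rewrite mulrBr mulrBl mulr_algl mulr_algr; congr (_ - _).
  by rewrite -sz mulrA.
rewrite -sz cnorm_sqr // -[leRHS]ger0_norm //.
by apply: (cnorm_le_of_sum_sqr s t) => //; rewrite sz tz addrC subrK.
Qed.

(** This replaces the existential radius by any prescribed bound of the norm. *)
Lemma norm_cone_cnorm r a : norm_cone a -> cnorm a <= r -> cnorm (r%:C%:A - a) <= r.
Proof.
move=> aP ar; apply: cnorm_le_of_cone; last by rewrite subKr.
by apply: norm_cone_sub => //; case: aP.
Qed.

(** With [k = ‖s‖^2], the element [k - s^2] has a root [t] commuting with [s]; then
    [‖k - s^2‖ = ‖t‖^2 <= k]. *)
Lemma norm_cone_sqr s : star s = s -> norm_cone (s * s).
Proof.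
move=> ss; have sss : star (s * s) = s * s by rewrite starM ss.
split=> //; exists (cnorm s ^+ 2).
have rP : norm_cone ((cnorm s ^+ 2)%:C%:A - s * s).
  by apply: norm_cone_sub => //; rewrite cnorm_sqr.
have [t [_ [st tz _ tC]]] := norm_cone_sqrt _ rP.
have stC : s * t = t * s.
  by apply: tC; rewrite mulrBr mulrBl mulr_algl mulr_algr mulrA.
rewrite -tz cnorm_sqr // -[leRHS]ger0_norm ?exprn_ge0 ?cnorm_ge0 //.
by apply: (cnorm_le_of_sum_sqr t s) => //; rewrite tz subrK.
Qed.

(** * Spectral positivity versus the norm cone *)

Lemma spectrum_disc a l m : spectrum a l -> normc (l - m) <= cnorm (a - m%:A).
Proof.
move=> al; rewrite leNgt; apply/negP => lt_d; apply: al.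
pose d := l - m.
have d0 : d != 0.
  by apply: contraTneq lt_d; rewrite -/d => ->; rewrite normc0 -leNgt cnorm_ge0.
(* Outside the disc, [a - l] is [- d] times this factor, which the Neumann series inverts. *)
have [b [b1 b2]] : exists b, (1 - d^-1 *: (a - m%:A)) * b = 1 /\
                             b * (1 - d^-1 *: (a - m%:A)) = 1.
  apply: neumann; rewrite cnormZ normcV mulrC ltr_pdivrMr ?mul1r //.
  exact: le_lt_trans (cnorm_ge0 _) lt_d.
have aE : a - l%:A = (- d) *: (1 - d^-1 *: (a - m%:A)).
  rewrite scalerBr scalerA mulNr mulfV // !scaleNr scale1r opprK.
  by rewrite /d scalerBl opprB [RHS]addrC addrA subrK.
exists ((- d)^-1 *: b); rewrite aE -!scalerAl -!scalerAr !scalerA.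
by rewrite mulfV ?mulVf ?oppr_eq0 // !scale1r.
Qed.

(* Compare the distances of [l] and [a] to the points [i t], for [t] large. *)
Lemma spectrum_real a l : star a = a -> spectrum a l -> complex.Im l = 0.
Proof.
case: l => p q sa al /=; apply/eqP/negPn/negP => q0.
have bound (t : R) : p ^+ 2 + (q - t) ^+ 2 <= cnorm a ^+ 2 + t ^+ 2.
  pose m : R[i] := (0 +i* t)%C.
  have := spectrum_disc _ _ m al.
  have st : star (a - m%:A) = a + m%:A.
    rewrite starB starZ star1 sa -scaleNr; congr (_ + _ *: _).
    by apply/eqP; rewrite eq_complex /= oppr0 opprK !eqxx.
  rewrite -(ler_pXn2r (ltn0Sn 1)) ?nnegrE ?cnorm_ge0 ?sqrtr_ge0 //.
  rewrite /= sqr_sqrtr ?addr_ge0 ?sqr_ge0 // subr0.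
  rewrite -(cnorm_starM (a - m%:A)) st => /le_trans; apply.
  have -> : (a + m%:A) * (a - m%:A) = a * a + (t ^+ 2)%:C%:A.
    rewrite mulrBr !mulrDl mulr_algl !mulr_algr opprD addrA addrK.
    congr (_ + _); rewrite scalerA -scaleNr; congr (_ *: _).
    by apply/eqP; rewrite eq_complex /=; apply/andP; split; apply/eqP; ring.
  apply: le_trans (cnormD _ _) _; rewrite cnorm_sqr // cnorm_real.
  by rewrite ger0_norm ?sqr_ge0.
(* This [t] solves [- 2 q t = ‖a‖^2 + 1], so the left side of [bound] exceeds the right by
   [p^2 + q^2 + 1]. *)
have := bound (- (cnorm a ^+ 2 + 1) / (2 * q)).
have -> : (q - - (cnorm a ^+ 2 + 1) / (2 * q)) ^+ 2 =
  q ^+ 2 + (cnorm a ^+ 2 + 1) + (- (cnorm a ^+ 2 + 1) / (2 * q)) ^+ 2 by field.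
have := sqr_ge0 p; have := sqr_ge0 q; lra.
Qed.

Lemma cstar_pos_of_disc r s : star s = s -> cnorm (r%:C%:A - s) <= r -> cstar_pos s.
Proof.
move=> ss sr; split=> // l sl; have := spectrum_disc _ _ r%:C sl.
have := spectrum_real _ _ ss sl; case: l {sl} => p q /= ->.
rewrite oppr0 addr0 expr0n addr0 sqrtr_sqr cnorm_distC lecE /= eqxx => pr.
by have := ler_norm (r - p); rewrite distrC; lra.
Qed.

(* The set of [t] in [0, ‖a‖] with [a + t] in the cone is closed, and its
   infimum [T] is 0: otherwise [a + T = s * s] is invertible with inverse [b],
   and [a + T - d = s * (1 - d b) * s] is again a square for small [d > 0]. *)
Lemma cstar_pos_norm_cone a : cstar_pos a -> norm_cone a.
Proof.
move=> [sa spa]; pose N := cnorm a; have N0 : 0 <= N := cnorm_ge0 a.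
(* The radius [2 * N] bounds [‖a + t‖] for all [t] in [[0, N]]; keeping it fixed is what makes [S]
   closed. *)
pose S := [set t : R | 0 <= t <= N /\
  cnorm ((2 * N)%:C%:A - (a + t%:C%:A)) <= 2 * N]%classic.
have SN : S N.
  split; first by rewrite N0 lexx.
  rewrite opprD addrCA -scalerBl -rmorphB.
  apply: le_trans (cnormD _ _) _; rewrite cnormN cnorm_real ger0_norm -/N; lra.
have infS : has_inf S by split; [exists N | exists 0 => t [/andP[]]].
set T := inf S.
have T0 : 0 <= T by apply: lb_le_inf; [exists N | move=> t [/andP[]]].
have TN : T <= N by apply: ge_inf SN; case: infS.
have ST : S T.
  split; first by rewrite T0 TN.
  apply/ler_addgt0Pr => e e0.
  have [t tS tT] := inf_adherent e0 infS; have [_ St] := tS.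
  have Tt : T <= t by apply: ge_inf tS; case: infS.
  have := cnorm_triangle (a + t%:C%:A) (2 * N)%:C%:A (a + T%:C%:A).
  have -> : a + t%:C%:A - (a + T%:C%:A) = (t - T)%:C%:A.
    by rewrite opprD addrACA subrr add0r -scalerBl -rmorphB.
  rewrite cnorm_real ger0_norm ?subr_ge0 //; lra.
have star_shift t : star (a + t%:C%:A) = a + t%:C%:A by rewrite starD sa star_real.
have [T_eq0|T_neq0] := eqVneq T 0.
  by case: ST => _; rewrite T_eq0 rmorph0 scale0r addr0; split=> //; exists (2 * N).
have T_gt0 : 0 < T by rewrite lt_def T_neq0.
set aT := a + T%:C%:A; have saT : star aT = aT := star_shift T.
have [b [aTb baT]] : exists b, aT * b = 1 /\ b * aT = 1.
  have : ~ spectrum a (- T)%:C by move/spa; rewrite lecR; lra.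
  by move/contrapT; rewrite rmorphN scaleNr opprK.
have sb : star b = b.
  have : star b * aT = 1 by rewrite -{1}saT -starM aTb star1.
  by move=> sbaT; rewrite -[star b]mulr1 -aTb mulrA sbaT mul1r.
have M_gt0 : 0 < cnorm b.
  rewrite lt_def cnorm_ge0 andbT; apply: contraTneq isT => /cnorm_eq0 b0.
  by move/eqP: aTb; rewrite b0 mulr0 eq_sym oner_eq0.
have aTP : norm_cone aT by split=> //; exists (2 * N); case: ST.
have [s [_ [ss sE _ _]]] := norm_cone_sqrt _ aTP.
have sbC : s * b = b * s.
  by rewrite -[s * b]mul1r -[b * s in RHS]mulr1 -{1}baT -aTb -sE !mulrA.
(* The first bound keeps [T - d] nonnegative, the second gives [‖d b‖ <= 1], so that [1 - d b] is in
   the cone. *)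
pose d := Num.min T (cnorm b)^-1.
have d_gt0 : 0 < d by rewrite lt_min T_gt0 invr_gt0.
have dT : d <= T by rewrite ge_min lexx.
have dbP : norm_cone (1 - d%:C *: b).
  have := norm_cone_sub 1 (d%:C *: b).
  rewrite rmorph1 scale1r; apply; first by rewrite starZr sb.
  by rewrite cnormZr gtr0_norm // -ler_pdivlMr // div1r ge_min lexx orbT.
have [w [_ [sw wE _ wC]]] := norm_cone_sqrt _ dbP.
have swC : s * w = w * s.
  by apply: wC; rewrite mulrBr mulrBl mulr1 mul1r -scalerAr -scalerAl sbC.
have swP : norm_cone ((s * w) * (s * w)).
  by apply: norm_cone_sqr; rewrite starM ss sw swC.
have swE : (s * w) * (s * w) = a + (T - d)%:C%:A.
  rewrite {1}swC mulrA -(mulrA w) sE.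
  have -> : w * aT = aT * w by rewrite -sE mulrA -swC -mulrA -swC mulrA.
  by rewrite -mulrA wE mulrBr mulr1 -scalerAr aTb rmorphB scalerBl addrA.
have : T <= T - d.
  apply: ge_inf; first by case: infS.
  split; first by lra.
  apply: norm_cone_cnorm; first by rewrite -swE.
  apply: le_trans (cnormD _ _) _; rewrite cnorm_real ger0_norm -/N; lra.
by lra.
Qed.

End NormCone.

(** * The module norm and its convexity along segments *)

Section Module.
Context {R : realType} {A : cstarAlgType R} {E : preHilbertModType A}.
Implicit Types (x w : E) (t : R).

(** The cone provides a root whose disc bound makes it spectrally positive, so [xget] does not fall
    back on its default 0. *)
Lemma cstar_sqrt_spec (a : A) : cstar_pos a ->
  cstar_pos (cstar_sqrt a) /\ cstar_sqrt a ^+ 2 = a.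
Proof.
move=> /cstar_pos_norm_cone/norm_cone_sqrt[s [r [ss sE sr _]]].
apply: (@xgetPex _ 0 [set b : A | cstar_pos b /\ b ^+ 2 = a]%classic).
by exists s; split; [exact: cstar_pos_of_disc ss sr | rewrite expr2].
Qed.

Lemma mod_abs_sqr x : mod_abs x ^+ 2 = inner x x.
Proof. by have [] := cstar_sqrt_spec _ (inner_pos x). Qed.

Lemma mod_norm_sqr x : mod_norm x ^+ 2 = cnorm (inner x x).
Proof.
rewrite -mod_abs_sqr expr2 cnorm_sqr //.
by have [[]] := cstar_sqrt_spec _ (inner_pos x).
Qed.

Lemma mod_norm_ge0 x : 0 <= mod_norm x.
Proof. exact: cnorm_ge0. Qed.

Lemma inner_segment x w t :
  inner (x + t%:C *: w) (x + t%:C *: w) =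
  (1 - t)%:C *: inner x x + t%:C *: inner (x + w) (x + w)
    - (t * (1 - t))%:C *: inner w w.
Proof.
rewrite !innerDl !innerDr !innerZl !innerZr conj_real scalerA.
rewrite mulrBr mulr1 !rmorphB !rmorphM rmorph1 !scalerBl scale1r !scalerDr.
move: (inner x x) (inner x w) (inner w x) (inner w w) => a b c d.
rewrite opprB !addrA subrK -!addrA; do 3 congr (_ + _).
by rewrite addrCA subrr addr0.
Qed.

(* [|x + t w|^2 = |x|^2 + t Q + t^2 beta e] with [Q] self-adjoint, and the
   largest spectral value of [|x|^2 + t Q] is convex in [t]. *)
Lemma mod_norm_segment x w t (beta : R) :
  0 <= t <= 1 -> inner w w = beta%:C%:A ->
  mod_norm (x + t%:C *: w) ^+ 2 <=
  (1 - t) * mod_norm x ^+ 2 + t * mod_norm (x + w) ^+ 2 - t * (1 - t) * beta.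
Proof.
move=> /andP[t0 t1] ww; rewrite !mod_norm_sqr.
have pos (v : E) := cstar_pos_norm_cone _ (inner_pos v).
have cone (v : E) : norm_cone ((cnorm (inner v v))%:C%:A - inner v v).
  by apply: norm_cone_sub; first exact: inner_star.
apply: cnorm_le_of_cone; first exact: pos.
have t1' : 0 <= 1 - t by lra.
(* By [inner_segment], this convex combination is the claimed bound minus the inner square of
   [x + t w]. *)
have := norm_coneD _ _ (norm_coneZ _ _ t1' (cone x)) (norm_coneZ _ _ t0 (cone (x + w))).
rewrite inner_segment ww.
rewrite (scalerBr _ (cnorm (inner x x))%:C%:A) (scalerBr _ (cnorm (inner (x + w) (x + w)))%:C%:A).
rewrite !scalerA -!rmorphM => coneD.
rewrite rmorphB rmorphD scalerBl scalerDl -addrA -opprD [X in _ - X]addrC subrK.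
by rewrite opprD addrACA.
Qed.

Lemma ge0_of_ge_scaled (g beta : R) : 0 <= beta ->
  (forall t, 0 < t <= 1 -> - (t * beta) <= g) -> 0 <= g.
Proof.
move=> b0 gb; rewrite leNgt; apply/negP => g0.
have d0 : 0 < 2 * (beta - g) by lra.
(* For [g < 0] this [t] gives [t * beta <= - g / 2 < - g], against the hypothesis. *)
have tE : - g / (2 * (beta - g)) * (2 * (beta - g)) = - g by field; lra.
set t := - g / _ in tE.
have t0 : 0 < t by rewrite divr_gt0 //; lra.
have t1 : t <= 1 by rewrite ler_pdivrMr //; lra.
have := gb t; rewrite t0 t1 => /(_ isT); nra.
Qed.

End Module.

Theorem theorem4p8 (R : realType) (A : cstarAlgType R) (alpha : R)
    (E : preHilbertModType A) (x y : E) :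
  0 < alpha ->
  lin_indep2 x y ->
  mod_abs y ^+ 2 = alpha%:C%:A ->
  pythagoras_orthogonal x y <->
  (parallelogram_law x y /\ birkhoff_james_orthogonal x y).
Proof.
move=> alpha0 _; rewrite mod_abs_sqr => yy.
have ny : mod_norm y ^+ 2 = alpha by rewrite mod_norm_sqr yy cnorm_real gtr0_norm.
have sqr_normc_ge0 (l : R[i]) : 0 <= normc l ^+ 2 * alpha.
  by rewrite mulr_ge0 ?sqr_ge0 ?ltW.
split=> [pyth|[par bj] l].
  split=> l; first by rewrite -scaleNr !pyth normcN; ring.
  rewrite -(ler_pXn2r (ltn0Sn 1)) ?nnegrE ?mod_norm_ge0 // pyth ny.
  by rewrite lerDl.
have excess_ge0 (m : R[i]) :
    0 <= mod_norm (x + m *: y) ^+ 2 - mod_norm x ^+ 2 - normc m ^+ 2 * alpha.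
  apply: (ge0_of_ge_scaled _ (normc m ^+ 2 * alpha)) => // t /andP[t0 t1].
  have mm : inner (m *: y) (m *: y) = (normc m ^+ 2 * alpha)%:C%:A.
    rewrite innerZl innerZr yy !scalerA; congr (_ *: _).
    case: m => p q; apply/eqP; rewrite eq_complex /= sqr_sqrtr ?addr_ge0 ?sqr_ge0 //.
    by apply/andP; split; apply/eqP; ring.
  have := mod_norm_segment x (m *: y) t _ _ mm; rewrite t1 ltW // => /(_ isT).
  (* Birkhoff-James at the scalar [t m] bounds the convex estimate from below; dividing by [t]
     leaves an excess of at least [- t |m|^2 alpha]. *)
  have : mod_norm x ^+ 2 <= mod_norm (x + t%:C *: (m *: y)) ^+ 2.
    by rewrite ler_pXn2r ?nnegrE ?mod_norm_ge0 // scalerA; exact: bj.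
  move: (mod_norm _ ^+ 2) (mod_norm x ^+ 2) (mod_norm (x + m *: y) ^+ 2).
  move=> f0 f1 f2 le1 le2.
  by rewrite -(ler_pM2l t0); nra.
(* The parallelogram law says that these two nonnegative excesses sum to 0. *)
have := excess_ge0 l; have := excess_ge0 (- l); have := par l.
by rewrite ny scaleNr normcN; lra.
Qed.
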